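(* An element $A\in \mathrm{SL}(3,\mathbb{H})$ is reversible in $\mathrm{SL}(3,\mathbb{H})$ if and only if it is conjugate in $\mathrm{SL}(3,\mathbb{H})$ to one of the following matrices: (i) $\begin{pmatrix} e^{\mathbf{i}\theta}&0&0\\0&e^{\mathbf{i}\phi}&0\\0&0&e^{\mathbf{i}\psi}\end{pmatrix}$, where $\theta,\phi,\psi\in[0,\pi]$; (ii) $\begin{pmatrix} re^{\mathbf{i}\theta}&0&0\\0&r^{-1}e^{\mathbf{i}\theta}&0\\0&0&e^{\mathbf{i}\psi}\end{pmatrix}$, where $r\in\mathbb{R}$, $r>0$, $r\neq 1$, and $\theta,\psi\in[0,\pi]$; (iii) $\begin{pmatrix} e^{\mathbf{i}\theta}&1&0\\0&e^{\mathbf{i}\theta}&0\\0&0&e^{\mathbf{i}\psi}\end{pmatrix}$, where $\theta,\psi\in[0,\pi]$; (iv) $\begin{pmatrix} e^{\mathbf{i}\theta}&1&0\\0&e^{\mathbf{i}\theta}&1\\0&0&e^{\mathbf{i}\theta}\end{pmatrix}$, where $\theta\in[0,\pi]$.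
   Context: $\mathbb{H}$ denotes Hamilton's real quaternions with units $\mathbf{i},\mathbf{j},\mathbf{k}$, and $\mathbb{C}=\mathbb{R}+\mathbb{R}\mathbf{i}\subset\mathbb{H}$. For $A\in \mathrm{M}(3,\mathbb{H})$ write $A=A_1+A_2\mathbf{j}$ with $A_1,A_2\in \mathrm{M}(3,\mathbb{C})$, and put $\det_{\mathbb{H}}(A):=\det\begin{pmatrix} A_1 & A_2\\ -\overline{A_2} & \overline{A_1}\end{pmatrix}$. Put $\mathrm{SL}(3,\mathbb{H})=\{g\in \mathrm{M}(3,\mathbb{H}) : \det_{\mathbb{H}}(g)=1\}$. An element $g$ of a group $G$ is called reversible in $G$ if it is conjugate to $g^{-1}$ in $G$. *)

(* Defs.v *)
From HB Require Import structures.
From mathcomp Require Import all_boot all_order all_algebra.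
From mathcomp Require Import ring.
From mathcomp Require Import complex.
From mathcomp Require Import reals trigo.

#[local] Set Warnings "-redundant-canonical-projection".
Set Implicit Arguments.
Unset Strict Implicit.
Unset Printing Implicit Defensive.

Import Order.TTheory GRing.Theory Num.Theory.
Local Open Scope ring_scope.

Section Quaternions.
Variable R : realType.

(* Quaternion a b c d stands for a + b i + c j + d k. *)
Record quaternion : Type := Quaternion
  { qre : R; qim_i : R; qim_j : R; qim_k : R }.

Definition tuple_of_quat (x : quaternion) : R * R * R * R :=
  let: Quaternion a b c d := x in (a, b, c, d).
Definition quat_of_tuple (t : R * R * R * R) : quaternion :=
  let: (a, b, c, d) := t in Quaternion a b c d.

Lemma tuple_of_quatK : cancel tuple_of_quat quat_of_tuple.
Proof. by case. Qed.

HB.instance Definition _ := Equality.copy quaternion (can_type tuple_of_quatK).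
HB.instance Definition _ := Choice.copy quaternion (can_type tuple_of_quatK).

Definition addq (x y : quaternion) : quaternion :=
  let: Quaternion a b c d := x in let: Quaternion a' b' c' d' := y in
  Quaternion (a + a') (b + b') (c + c') (d + d').

Definition oppq (x : quaternion) : quaternion :=
  let: Quaternion a b c d := x in Quaternion (- a) (- b) (- c) (- d).

Definition mulq (x y : quaternion) : quaternion :=
  let: Quaternion a b c d := x in let: Quaternion a' b' c' d' := y in
  Quaternion (a * a' - b * b' - c * c' - d * d')
             (a * b' + b * a' + c * d' - d * c')
             (a * c' - b * d' + c * a' + d * b')
             (a * d' + b * c' - c * b' + d * a').

Lemma addqA : associative addq.
Proof. by move=> [????] [????] [????] /=; rewrite !addrA. Qed.

Lemma addqC : commutative addq.
Proof. by move=> [????] [????] /=; congr Quaternion; rewrite addrC. Qed.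

Lemma add0q : left_id (Quaternion 0 0 0 0) addq.
Proof. by move=> [????] /=; rewrite !add0r. Qed.

Lemma addNq : left_inverse (Quaternion 0 0 0 0) oppq addq.
Proof. by move=> [????] /=; rewrite !addNr. Qed.

HB.instance Definition _ :=
  GRing.isZmodule.Build quaternion addqA addqC add0q addNq.

Lemma mulqA : associative mulq.
Proof. by move=> [????] [????] [????] /=; congr Quaternion; ring. Qed.

Lemma mul1q : left_id (Quaternion 1 0 0 0) mulq.
Proof. by move=> [????] /=; congr Quaternion; ring. Qed.

Lemma mulq1 : right_id (Quaternion 1 0 0 0) mulq.
Proof. by move=> [????] /=; congr Quaternion; ring. Qed.

Lemma mulqDl : left_distributive mulq addq.
Proof. by move=> [????] [????] [????] /=; congr Quaternion; ring. Qed.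

Lemma mulqDr : right_distributive mulq addq.
Proof. by move=> [????] [????] [????] /=; congr Quaternion; ring. Qed.

Lemma oneq_neq0 : Quaternion 1 0 0 0 != 0.
Proof. by apply/eqP => -[] /eqP; rewrite oner_eq0. Qed.

HB.instance Definition _ := GRing.Zmodule_isNzRing.Build quaternion
  mulqA mul1q mulq1 mulqDl mulqDr oneq_neq0.

Definition realq (r : R) : quaternion := Quaternion r 0 0 0.

Definition expiq (t : R) : quaternion := Quaternion (cos t) (sin t) 0 0.

(* x = cpart1 x + cpart2 x * j, as (c + d i) j = c j + d k. *)
Definition cpart1 (x : quaternion) : R[i] := Complex (qre x) (qim_i x).
Definition cpart2 (x : quaternion) : R[i] := Complex (qim_j x) (qim_k x).

Definition quat_of_parts (z w : R[i]) : quaternion :=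
  Quaternion (complex.Re z) (complex.Im z) (complex.Re w) (complex.Im w).

Lemma cpart1_is_additive : {morph cpart1 : x y / x + y}.
Proof. by move=> [????] [????]. Qed.

Lemma cpart2_is_additive : {morph cpart2 : x y / x + y}.
Proof. by move=> [????] [????]. Qed.

Lemma cpart1_sum (I : Type) (s : seq I) (F : I -> quaternion) :
  cpart1 (\sum_(i <- s) F i) = \sum_(i <- s) cpart1 (F i).
Proof. exact: (big_morph cpart1 cpart1_is_additive erefl). Qed.

Lemma cpart2_sum (I : Type) (s : seq I) (F : I -> quaternion) :
  cpart2 (\sum_(i <- s) F i) = \sum_(i <- s) cpart2 (F i).
Proof. exact: (big_morph cpart2 cpart2_is_additive erefl). Qed.

Lemma cpart1M x y :
  cpart1 (x * y) = cpart1 x * cpart1 y - cpart2 x * conjc (cpart2 y).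
Proof.
by case: x y => [????] [????]; apply/eqP; rewrite eq_complex /=;
  apply/andP; split; apply/eqP; ring.
Qed.

Lemma cpart2M x y :
  cpart2 (x * y) = cpart1 x * cpart2 y + cpart2 x * conjc (cpart1 y).
Proof.
by case: x y => [????] [????]; apply/eqP; rewrite eq_complex /=;
  apply/andP; split; apply/eqP; ring.
Qed.

Section ComplexRepresentation.
Variable n : nat.
Implicit Types A B : 'M[quaternion]_n.

Definition complex_rep A : 'M[R[i]]_(n + n) :=
  block_mx (map_mx cpart1 A) (map_mx cpart2 A)
           (- map_mx conjc (map_mx cpart2 A)) (map_mx conjc (map_mx cpart1 A)).

Definition detH A : R[i] := \det (complex_rep A).

(* Left inverse of complex_rep. *)
Definition quat_mx_of_rep (M : 'M[R[i]]_(n + n)) : 'M[quaternion]_n :=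
  \matrix_(i, j) quat_of_parts (ulsubmx M i j) (ursubmx M i j).

Lemma complex_repK : cancel complex_rep quat_mx_of_rep.
Proof.
move=> A; apply/matrixP=> i j.
by rewrite mxE /complex_rep block_mxKul block_mxKur !mxE; case: (A i j).
Qed.

Lemma map_cpart1_mulmx A B : map_mx cpart1 (A *m B) =
  map_mx cpart1 A *m map_mx cpart1 B
  - map_mx cpart2 A *m map_mx conjc (map_mx cpart2 B).
Proof.
apply/matrixP=> i j; rewrite !mxE cpart1_sum -sumrB.
by apply: eq_bigr => k _; rewrite !mxE cpart1M.
Qed.

Lemma map_cpart2_mulmx A B : map_mx cpart2 (A *m B) =
  map_mx cpart1 A *m map_mx cpart2 B
  + map_mx cpart2 A *m map_mx conjc (map_mx cpart1 B).
Proof.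
apply/matrixP=> i j; rewrite !mxE cpart2_sum -big_split.
by apply: eq_bigr => k _; rewrite !mxE cpart2M.
Qed.

Lemma map_conjcK m p (M : 'M[R[i]]_(m, p)) : map_mx conjc (map_mx conjc M) = M.
Proof. by apply/matrixP=> i j; rewrite !mxE conjcK. Qed.

Lemma complex_repM A B :
  complex_rep (A *m B) = complex_rep A *m complex_rep B.
Proof.
rewrite /complex_rep mulmx_block map_cpart1_mulmx map_cpart2_mulmx.
rewrite !map_mxD !map_mxN !map_mxM !map_conjcK !mulmxN !mulNmx opprD.
by congr block_mx; rewrite addrC.
Qed.

Lemma complex_rep1 : complex_rep 1%:M = 1%:M.
Proof.
rewrite /complex_rep [RHS](@scalar_mx_block _ n n).
have -> : map_mx cpart1 1%:M = 1%:M :> 'M_n.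
  by apply/matrixP=> i j; rewrite !mxE; case: eqP.
have -> : map_mx cpart2 1%:M = 0 :> 'M_n.
  by apply/matrixP=> i j; rewrite !mxE; case: eqP.
by rewrite map_mx1 map_mx0 oppr0.
Qed.

Definition symplectic_mx : 'M[R[i]]_(n + n) := block_mx 0 1%:M (- 1%:M) 0.

Lemma symplectic_mxK : symplectic_mx *m symplectic_mx = - 1%:M.
Proof.
rewrite mulmx_block !mulmx0 !mul0mx !mulmx1 !mul1mx !(addr0, add0r).
by rewrite [in RHS](@scalar_mx_block _ n n) opp_block_mx oppr0.
Qed.

Lemma complex_rep_symplectic A :
  map_mx conjc (complex_rep A) *m symplectic_mx =
  symplectic_mx *m complex_rep A.
Proof.
rewrite /complex_rep map_block_mx !map_mxN !map_conjcK !mulmx_block.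
by rewrite !(mulmx0, mul0mx, mulmxN, mulmx1, mul1mx, mulNmx, opprK, addr0, add0r).
Qed.

Lemma quat_mx_of_repK (M : 'M[R[i]]_(n + n)) :
  map_mx conjc M *m symplectic_mx = symplectic_mx *m M ->
  complex_rep (quat_mx_of_rep M) = M.
Proof.
rewrite -[M]submxK; set M1 := ulsubmx M; set M2 := ursubmx M.
set M3 := dlsubmx M; set M4 := drsubmx M.
rewrite map_block_mx !mulmx_block.
rewrite !(mulmx0, mul0mx, mulmxN, mulmx1, mul1mx, mulNmx, addr0, add0r).
case/eq_block_mx=> /(congr1 -%R); rewrite opprK => eq3 eq4 _ _.
rewrite /complex_rep /quat_mx_of_rep block_mxKul block_mxKur.
have -> : map_mx cpart1
    (\matrix_(i, j) quat_of_parts (M1 i j) (M2 i j)) = M1.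
  by apply/matrixP=> i j; rewrite !mxE; case: (M _ _).
have -> : map_mx cpart2
    (\matrix_(i, j) quat_of_parts (M1 i j) (M2 i j)) = M2.
  by apply/matrixP=> i j; rewrite !mxE; case: (M _ (rshift _ _)).
by rewrite eq3 eq4 opprK.
Qed.

Definition invH A : 'M[quaternion]_n := quat_mx_of_rep (invmx (complex_rep A)).

Lemma complex_rep_inv A : detH A = 1 ->
  complex_rep (invH A) = invmx (complex_rep A).
Proof.
move=> detA; apply: quat_mx_of_repK.
have uA : complex_rep A \in unitmx by rewrite unitmxE -/(detH A) detA unitr1.
have ucA : map_mx conjc (complex_rep A) \in unitmx by rewrite map_unitmx.
rewrite map_invmx -[LHS]mulmx1 -(mulmxV uA) mulmxA -(mulmxA (invmx _)).
by rewrite -complex_rep_symplectic [in LHS]mulmxA (mulVmx ucA) mul1mx.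
Qed.

End ComplexRepresentation.

Definition SLH_pred n : pred 'M[quaternion]_n := fun A => detH A == 1.

Record SLH n : Type := MkSLH { SLH_val :> 'M[quaternion]_n; _ : SLH_pred SLH_val }.

HB.instance Definition _ n := [isSub for @SLH_val n].
HB.instance Definition _ n := [Choice of SLH n by <:].

Section SLHGroup.
Variable n : nat.
Implicit Types x y : SLH n.

Lemma SLH_detE x : detH (val x) = 1.
Proof. exact/eqP/(valP x). Qed.

Lemma SLH_unit x : complex_rep (val x) \in unitmx.
Proof. by rewrite unitmxE -/(detH _) SLH_detE unitr1. Qed.

Lemma SLH_one_subproof : SLH_pred (1%:M : 'M[quaternion]_n).
Proof. by rewrite /SLH_pred /detH complex_rep1 det1. Qed.

Lemma SLH_mul_subproof x y : SLH_pred (val x *m val y).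
Proof.
by rewrite /SLH_pred /detH complex_repM det_mulmx -!/(detH _) !SLH_detE mulr1.
Qed.

Lemma SLH_inv_subproof x : SLH_pred (invH (val x)).
Proof.
rewrite /SLH_pred /detH complex_rep_inv ?SLH_detE // det_inv -/(detH _).
by rewrite SLH_detE invr1.
Qed.

Definition SLH_one : SLH n := MkSLH SLH_one_subproof.
Definition SLH_mul x y : SLH n := MkSLH (SLH_mul_subproof x y).
Definition SLH_inv x : SLH n := MkSLH (SLH_inv_subproof x).

Lemma SLH_mulA : associative SLH_mul.
Proof. by move=> x y z; apply: val_inj; rewrite /= mulmxA. Qed.

Lemma SLH_mul1 : left_id SLH_one SLH_mul.
Proof. by move=> x; apply: val_inj; rewrite /= mul1mx. Qed.

Lemma SLH_mulr1 : right_id SLH_one SLH_mul.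
Proof. by move=> x; apply: val_inj; rewrite /= mulmx1. Qed.

Lemma SLH_mulV : left_inverse SLH_one SLH_inv SLH_mul.
Proof.
move=> x; apply: val_inj; apply: (can_inj (@complex_repK n)) => /=.
by rewrite complex_repM complex_rep_inv ?SLH_detE // mulVmx ?SLH_unit ?complex_rep1.
Qed.

Lemma SLH_mulrV : right_inverse SLH_one SLH_inv SLH_mul.
Proof.
move=> x; apply: val_inj; apply: (can_inj (@complex_repK n)) => /=.
by rewrite complex_repM complex_rep_inv ?SLH_detE // mulmxV ?SLH_unit ?complex_rep1.
Qed.

HB.instance Definition _ := isGroup.Build (SLH n)
  SLH_mulA SLH_mul1 SLH_mulr1 SLH_mulV SLH_mulrV.

End SLHGroup.

Definition mx33 (a b c d e f g h k : quaternion) : 'M[quaternion]_3 :=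
  \matrix_(i, j) nth 0 (nth [::] [:: [:: a; b; c];
                                     [:: d; e; f];
                                     [:: g; h; k]] i) j.

End Quaternions.

Arguments realq {R} r.
Arguments expiq {R} t.

Definition conjugate (G : groupType) (x y : G) : Prop :=
  exists g : G, (x ^ g)%g = y.

Definition reversible (G : groupType) (x : G) : Prop := conjugate x (x^-1)%g.

(* Main.v *)
Require Import Defs.
From mathcomp Require Import all_boot all_order all_algebra.
From mathcomp Require Import ring complex.
From mathcomp Require Import reals sequences exp trigo.
Import Order.TTheory GRing.Theory Num.Theory.
Local Open Scope ring_scope.

Set Implicit Arguments.
Unset Strict Implicit.
Unset Printing Implicit Defensive.

(* If A^g = A^-1 and h is a left row eigenvector, h A = l h, then h g is a left
   row eigenvector for l^-1.  When A is in Jordan form, with eigenvalues l1, l2,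
   l3 in the closed upper half-plane, reading h g A = l^-1 (h g) at the first
   nonzero coordinate of h g gives l * conj l_i = 1 for some i: the spectrum is
   stable under l |-> l / |l|^2.  Together with |l1 l2 l3| = 1 this leaves only
   unimodular eigenvalues, or a pair r e^(i t), r^-1 e^(i t) and a unimodular
   third one in the diagonalizable case.  The Jordan form itself is obtained by
   conjugating with transvections, since x |-> l x - x m is bijective on H for
   l != m in the half-plane.  Conjugacy in GL(3, H) and SL(3, H) agree on
   SL(3, H) because detH is positive on invertible matrices. *)

Section ReversibleSL3H.
Variable R : realType.
Local Notation H := (quaternion R).
Local Notation C := R[i].
Local Notation SL3 := (SLH R 3).
Implicit Types (q x y a b c : H) (z w l m : C).

(** * Quaternions as pairs of complex numbers *)

(* The quaternions z and z j. *)
Definition cq z : H := quat_of_parts z 0.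
Definition jq z : H := quat_of_parts 0 z.

Lemma quat_parts q : q = cq (cpart1 q) + jq (cpart2 q).
Proof. by case: q => a b c d; congr Quaternion; rewrite /= ?addr0 ?add0r. Qed.

Lemma cpart_inj q q' : cpart1 q = cpart1 q' -> cpart2 q = cpart2 q' -> q = q'.
Proof. by move=> e1 e2; rewrite (quat_parts q) (quat_parts q') e1 e2. Qed.

Lemma cpart1_cq z : cpart1 (cq z) = z. Proof. by case: z. Qed.
Lemma cpart2_cq z : cpart2 (cq z) = 0. Proof. by []. Qed.
Lemma cpart1_jq z : cpart1 (jq z) = 0. Proof. by []. Qed.
Lemma cpart2_jq z : cpart2 (jq z) = z. Proof. by case: z. Qed.

Lemma cq0 : cq 0 = 0. Proof. by []. Qed.
Lemma jq0 : jq 0 = 0. Proof. by []. Qed.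

Lemma cpart10 : cpart1 (0 : H) = 0. Proof. by []. Qed.
Lemma cpart20 : cpart2 (0 : H) = 0. Proof. by []. Qed.
Lemma cpart11 : cpart1 (1 : H) = 1. Proof. by []. Qed.
Lemma cpart21 : cpart2 (1 : H) = 0. Proof. by []. Qed.

(** After [cpart_inj], these rules turn an identity in H into two identities over C in the parts and
    their conjugates. *)
Definition cpartE := (cpart1_is_additive, cpart2_is_additive, cpart1M, cpart2M,
  cpart1_cq, cpart2_cq, cpart1_jq, cpart2_jq, cpart10, cpart20, cpart11,
  cpart21, conjc0, mulr0, mul0r, oppr0, addr0, add0r, subr0).

Lemma cqD z w : cq (z + w) = cq z + cq w.
Proof. by apply: cpart_inj; rewrite !cpartE. Qed.

Lemma jqD z w : jq (z + w) = jq z + jq w.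
Proof. by apply: cpart_inj; rewrite !cpartE. Qed.

Lemma cqM z w : cq z * cq w = cq (z * w).
Proof. by apply: cpart_inj; rewrite !cpartE. Qed.

Lemma cqjM z w : cq z * jq w = jq (z * w).
Proof. by apply: cpart_inj; rewrite !cpartE. Qed.

Lemma jcqM z w : jq z * cq w = jq (z * conjc w).
Proof. by apply: cpart_inj; rewrite !cpartE. Qed.

Lemma jqM z w : jq z * jq w = cq (- (z * conjc w)).
Proof. by apply: cpart_inj; rewrite !cpartE. Qed.

(** * Norm and inverse of a quaternion *)

Definition qnorm q : R :=
  qre q ^+ 2 + qim_i q ^+ 2 + qim_j q ^+ 2 + qim_k q ^+ 2.

Definition qinv q : H := Quaternion (qre q / qnorm q) (- qim_i q / qnorm q)
  (- qim_j q / qnorm q) (- qim_k q / qnorm q).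

Lemma qnorm_eq0 q : (qnorm q == 0) = (q == 0).
Proof.
case: q => a b c d; rewrite /qnorm /= !paddr_eq0 ?addr_ge0 ?sqr_ge0 //.
rewrite !expf_eq0 /=; apply/idP/eqP => [|[-> -> -> ->]]; last by rewrite eqxx.
by case/andP => /andP[/andP[/eqP-> /eqP->]] /eqP-> /eqP->.
Qed.

Lemma qmulV q : q != 0 -> q * qinv q = 1.
Proof.
rewrite -qnorm_eq0; case: q => a b c d; rewrite /qinv /qnorm /= => n0.
by congr Quaternion; field.
Qed.

Lemma qmulVl q : q != 0 -> qinv q * q = 1.
Proof.
rewrite -qnorm_eq0; case: q => a b c d; rewrite /qinv /qnorm /= => n0.
by congr Quaternion; field.
Qed.

(** * Similarity and triangularization *)

(** Conjugacy under GL(n, H). The two-sided inverse is an explicit witness, so that no determinant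
    is involved at this stage. *)
Definition qsimilar n (A B : 'M[H]_n) := exists P Q : 'M[H]_n,
  [/\ P *m Q = 1%:M, Q *m P = 1%:M & P *m A = B *m P].

Lemma qsimilar_refl n (A : 'M[H]_n) : qsimilar A A.
Proof. by exists 1%:M, 1%:M; split; rewrite ?mulmx1 ?mul1mx. Qed.

Lemma qsimilar_trans n (B A D : 'M[H]_n) :
  qsimilar A B -> qsimilar B D -> qsimilar A D.
Proof.
move=> [P [Q [PQ QP eP]]] [P' [Q' [PQ' QP' eP']]].
exists (P' *m P), (Q *m Q'); split.
- by rewrite -mulmxA [P *m _]mulmxA PQ mul1mx.
- by rewrite -mulmxA [Q' *m _]mulmxA QP' mul1mx.
- by rewrite -mulmxA eP !mulmxA eP'.
Qed.

Lemma qsimilar_conj n (A P Q : 'M[H]_n) : P *m Q = 1%:M -> Q *m P = 1%:M ->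
  qsimilar A (P *m A *m Q).
Proof.
by move=> PQ QP; exists P, Q; split=> //; rewrite -[RHS]mulmxA QP mulmx1.
Qed.

(** The row h = v1 + v2 j has parts [v1], [v2]. On the pair of parts, right multiplication of h by A
    is right multiplication by [complex_rep A], and left multiplication of h by a complex number is
    scaling. So a complex row eigenvector of [complex_rep A] yields one of A. *)
Lemma row_eigenvector n (A : 'M[H]_n.+1) : exists (l : C) (h : 'rV[H]_n.+1),
  [/\ 0 <= complex.Im l, h != 0 & h *m A = cq l *: h].
Proof.
have [//|l] := Theorem7' (complex_rep A).
move=> /eigenvalueP[u uA u0].
pose v1 := lsubmx u; pose v2 := rsubmx u.
pose h : 'rV[H]_n.+1 := \row_j quat_of_parts (v1 0 j) (v2 0 j).
have h0 : h != 0.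
  apply: contra_neq u0 => h0; rewrite -[u]hsubmxK -/v1 -/v2.
  suff [-> ->] : v1 = 0 /\ v2 = 0 by rewrite row_mx0.
  by split; apply/rowP => j; move/rowP: h0 => /(_ j); rewrite !mxE;
    [move/(congr1 (@cpart1 R))|move/(congr1 (@cpart2 R))];
    rewrite ?cpart1_cq /cpart1 /cpart2 /=; case: (u _ _).
have hA : h *m A = cq l *: h.
  move: uA; rewrite -[u]hsubmxK -/v1 -/v2 /complex_rep mul_row_block.
  rewrite scale_row_mx => /eq_row_mx[e1 e2].
  have vE1 j : cpart1 (h 0 j) = v1 0 j by rewrite mxE; case: (v1 0 j).
  have vE2 j : cpart2 (h 0 j) = v2 0 j by rewrite mxE; case: (v2 0 j).
  clearbody h v1 v2; apply/rowP => j; apply: cpart_inj.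
    rewrite [in RHS]mxE !cpartE vE1; move/rowP: e1 => /(_ j).
    rewrite [in RHS]mxE => <-; rewrite !mxE cpart1_sum -big_split /=.
    by apply: eq_bigr => k _; rewrite !mxE !cpartE vE1 vE2 mulrN.
  rewrite [in RHS]mxE !cpartE vE2; move/rowP: e2 => /(_ j).
  rewrite [in RHS]mxE => <-; rewrite !mxE cpart2_sum -big_split /=.
  by apply: eq_bigr => k _; rewrite !mxE !cpartE vE1 vE2.
have [l0|l0] := leP 0 (complex.Im l); first by exists l, h.
(* Since j l = conj(l) j, passing from h to j h conjugates the eigenvalue. *)
exists (conjc l), (jq 1 *: h); split.
- by move: l0; case: (l) => a b /=; rewrite oppr_ge0 => /ltW.
- apply: contra_neq h0.
  move=> /(congr1 (fun g : 'rV[H]_n.+1 => qinv (jq 1 : H) *: g)).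
  rewrite scalerA qmulVl ?scale1r ?scaler0 //.
  apply/eqP => /(congr1 (@cpart2 R)); rewrite cpart2_jq => /eqP.
  by rewrite oner_eq0.
- by rewrite -scalemxAl hA !scalerA cqjM jcqM mulr1 mul1r.
Qed.

(** A transposition moves a nonzero coordinate to the front. A row with nonzero leading entry,
    completed by rows of the identity, is a block triangular matrix with an explicit inverse. *)
Lemma row_complete n (h : 'rV[H]_(1 + n)) : h != 0 ->
  exists P Q : 'M[H]_(1 + n),
    [/\ P *m Q = 1%:M, Q *m P = 1%:M & usubmx P = h].
Proof.
move=> h0.
have [k hk] : exists k, h 0 k != 0.
  apply/existsP; apply: contra_neqT h0; rewrite negb_exists => /forallP h0.
  by apply/rowP => k; rewrite mxE; apply/eqP; rewrite -[_ == _]negbK.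
pose S : 'M[H]_(1 + n) := tperm_mx 0 k.
have SS : S *m S = 1%:M by rewrite -perm_mxM perm.tperm2 perm_mx1.
pose h' : 'rV[H]_(1 + n) := col_perm (perm.tperm 0 k) h; pose a := lsubmx h'.
have hS : h' *m S = h.
  by rewrite /h' col_permE perm.tpermV -mulmxA SS mulmx1.
have aE : a = (h 0 k)%:M.
  by rewrite [LHS]mx11_scalar; congr _%:M; rewrite !mxE lshift0 perm.tpermL.
pose P' : 'M[H]_(1 + n) := block_mx a (rsubmx h') 0 1%:M.
pose b : 'M[H]_1 := (qinv (h 0 k))%:M.
pose Q' : 'M[H]_(1 + n) := block_mx b (- (b *m rsubmx h')) 0 1%:M.
have ab : a *m b = 1%:M by rewrite aE -scalar_mxM qmulV.
have ba : b *m a = 1%:M by rewrite aE -scalar_mxM qmulVl.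
have PQ : P' *m Q' = 1%:M.
  rewrite mulmx_block !mulmx0 !mul0mx !mulmx1 mulmxN mulmxA ab mul1mx addNr.
  by rewrite !(addr0, add0r) [RHS]scalar_mx_block.
have QP : Q' *m P' = 1%:M.
  rewrite mulmx_block !mulmx0 !mul0mx !mulmx1 ba subrr.
  by rewrite !(addr0, add0r) [RHS]scalar_mx_block.
exists (P' *m S), (S *m Q'); split.
- by rewrite -mulmxA [S *m _]mulmxA SS mul1mx.
- by rewrite -mulmxA [Q' *m _]mulmxA QP mul1mx.
- by rewrite -mul_usub_mx /P' block_mxEv col_mxKu hsubmxK hS.
Qed.

(** Lower triangular, because a row eigenvector splits off the first row. *)
Definition halfplane_triang n (T : 'M[H]_n) :=
  (forall i j : 'I_n, (i < j)%N -> T i j = 0) /\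
  (forall i, exists l, 0 <= complex.Im l /\ T i i = cq l).

(** With a row eigenvector as first row of P, the first row of P A P^-1 is (l, 0, ..., 0); induction
    treats the lower right block. *)
Lemma triangularizable n (A : 'M[H]_n) :
  exists T, qsimilar A T /\ halfplane_triang T.
Proof.
elim: n A => [|n IHn] A.
  by exists A; split; [exact: qsimilar_refl|split=> [[]|[]]].
have [l [h [l_ge0 h0 hA]]] := row_eigenvector A.
have [P [Q [PQ QP Ph]]] := @row_complete n h h0.
pose B : 'M[H]_(1 + n) := P *m A *m Q.
have sB : @qsimilar n.+1 A B by apply: qsimilar_conj.
have hQ : h *m Q = row_mx 1%:M 0.
  rewrite -Ph mul_usub_mx PQ [X in usubmx X]scalar_mx_block block_mxEv.
  by rewrite col_mxKu.
have uB : usubmx B = row_mx (cq l)%:M 0.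
  rewrite /B -!mul_usub_mx Ph hA -scalemxAl hQ scale_row_mx scaler0.
  by rewrite scalemx1.
have [T' [[P' [Q' [PQ' QP' eP]]] [T'0 T'd]]] := IHn (drsubmx B).
pose S : 'M[H]_(1 + n) := block_mx 1%:M 0 0 P'.
pose S' : 'M[H]_(1 + n) := block_mx 1%:M 0 0 Q'.
pose T : 'M[H]_(1 + n) := block_mx (cq l)%:M 0 (P' *m dlsubmx B) T'.
exists T; split.
  apply: qsimilar_trans sB _; change (@qsimilar (1 + n) B T).
  exists S, S'; split.
  - rewrite mulmx_block !(mulmx0, mul0mx, mulmx1, addr0, add0r) PQ'.
    by rewrite [RHS]scalar_mx_block.
  - rewrite mulmx_block !(mulmx0, mul0mx, mulmx1, addr0, add0r) QP'.
    by rewrite [RHS]scalar_mx_block.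
  - rewrite -[B]submxK.
    have -> : ulsubmx B = (cq l)%:M by rewrite /ulsubmx uB row_mxKl.
    have -> : ursubmx B = 0 by rewrite /ursubmx uB row_mxKr.
    rewrite !mulmx_block !(mulmx0, mul0mx, mulmx1, mul1mx, addr0, add0r).
    by rewrite eP.
change (@halfplane_triang (1 + n) T); split=> [i j|i].
  case: (split_ordP i) => i' ->;
    case: (split_ordP j) => j' ->.
  - by rewrite !ord1.
  - by rewrite /T block_mxEur mxE.
  - by rewrite ord1.
  - by rewrite /T block_mxEdr /= ltn_add2l => /T'0.
case: (split_ordP i) => i' ->.
  by exists l; rewrite /T block_mxEul ord1 mxE eqxx.
by rewrite /T block_mxEdr; apply: T'd.
Qed.

(** * Elementary conjugations of 3 x 3 triangular matrices *)

Lemma mx33M (a1 a2 a3 b1 b2 b3 c1 c2 c3 d1 d2 d3 e1 e2 e3 f1 f2 f3 : H) :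
  mx33 a1 a2 a3 b1 b2 b3 c1 c2 c3 *m mx33 d1 d2 d3 e1 e2 e3 f1 f2 f3 =
  mx33 (a1 * d1 + a2 * e1 + a3 * f1) (a1 * d2 + a2 * e2 + a3 * f2)
         (a1 * d3 + a2 * e3 + a3 * f3)
       (b1 * d1 + b2 * e1 + b3 * f1) (b1 * d2 + b2 * e2 + b3 * f2)
         (b1 * d3 + b2 * e3 + b3 * f3)
       (c1 * d1 + c2 * e1 + c3 * f1) (c1 * d2 + c2 * e2 + c3 * f2)
         (c1 * d3 + c2 * e3 + c3 * f3).
Proof.
apply/matrixP => i j; rewrite !mxE !big_ord_recl big_ord0 addr0 !mxE /= addrA.
by case: i => [[|[|[|?]]] ?] //=; case: j => [[|[|[|?]]] ?].
Qed.

Lemma mx33_1 : mx33 1 0 0 0 1 0 0 0 1 = 1%:M :> 'M[H]_3.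
Proof.
apply/matrixP => i j; rewrite !mxE.
by case: i => [[|[|[|?]]] ?] //=; case: j => [[|[|[|?]]] ?].
Qed.

Lemma mx33_eta (A : 'M[H]_3) : A = mx33 (A 0 0) (A 0 1) (A 0 2%:R)
  (A 1 0) (A 1 1) (A 1 2%:R) (A 2%:R 0) (A 2%:R 1) (A 2%:R 2%:R).
Proof.
apply/matrixP => i j; rewrite mxE.
by case: i => [[|[|[|?]]] ?] //=; case: j => [[|[|[|?]]] ?] //=;
  congr (A _ _); apply: val_inj.
Qed.

Definition upmx x1 x2 x3 a b c : 'M[H]_3 := mx33 x1 a b 0 x2 c 0 0 x3.

Definition simp33 := (mulr0, mul0r, mulr1, mul1r, addr0, add0r).

Lemma qsimilar_upmx (A : 'M[H]_3) : exists (l1 l2 l3 : C) (a b c : H),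
  [/\ 0 <= complex.Im l1, 0 <= complex.Im l2, 0 <= complex.Im l3 &
      qsimilar A (upmx (cq l1) (cq l2) (cq l3) a b c)].
Proof.
have [T [sT [T0 Td]]] := triangularizable A.
have [[l1 [h1 e1]] [l2 [h2 e2]]] := (Td 2%:R, Td 1).
have [l3 [h3 e3]] := Td 0.
exists l1, l2, l3, (T 2%:R 1), (T 2%:R 0), (T 1 0); split=> //.
apply: qsimilar_trans sT _; rewrite {1}[T]mx33_eta e1 e2 e3.
rewrite (T0 0 1) // (T0 0 2%:R) // (T0 1 2%:R) //.
(* Reversing the order of the coordinates turns lower triangular into upper triangular. *)
exists (mx33 0 0 1 0 1 0 1 0 0), (mx33 0 0 1 0 1 0 1 0 0).
by rewrite !mx33M !simp33 mx33_1.
Qed.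

(** The entry at the place of the transvection moves by a Sylvester term, here [x * x2 - x1 * x],
    and any side effect falls on the corner [b], which is therefore cleared last. When [x] commutes
    with a common eigenvalue the Sylvester term vanishes and only the side effect remains. *)
Lemma up_transvect12 x x1 x2 x3 a b c :
  qsimilar (upmx x1 x2 x3 a b c)
          (upmx x1 x2 x3 (a + x * x2 - x1 * x) (b + x * c) c).
Proof.
exists (mx33 1 x 0 0 1 0 0 0 1), (mx33 1 (- x) 0 0 1 0 0 0 1).
by rewrite !mx33M !simp33 addNr subrr [_ * x + _]addrC subrK mx33_1.
Qed.

Lemma up_transvect23 x x1 x2 x3 a b c :
  qsimilar (upmx x1 x2 x3 a b c)
          (upmx x1 x2 x3 a (b - a * x) (c + x * x3 - x2 * x)).
Proof.
exists (mx33 1 0 0 0 1 x 0 0 1), (mx33 1 0 0 0 1 (- x) 0 0 1).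
rewrite !mx33M !simp33 addNr subrr mx33_1; split=> //.
by rewrite [a * x + _]addrC subrK [_ * x + _]addrC subrK.
Qed.

Lemma up_transvect13 x x1 x2 x3 a b c :
  qsimilar (upmx x1 x2 x3 a b c)
          (upmx x1 x2 x3 a (b + x * x3 - x1 * x) c).
Proof.
exists (mx33 1 0 x 0 1 0 0 0 1), (mx33 1 0 (- x) 0 1 0 0 0 1).
by rewrite !mx33M !simp33 addNr subrr [_ * x + _]addrC subrK mx33_1.
Qed.

Lemma up_scale p q r x1 x2 x3 a b c : p != 0 -> q != 0 -> r != 0 ->
  qsimilar (upmx x1 x2 x3 a b c)
          (upmx (p * x1 * qinv p) (q * x2 * qinv q) (r * x3 * qinv r)
                (p * a * qinv q) (p * b * qinv r) (q * c * qinv r)).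
Proof.
move=> p0 q0 r0.
exists (mx33 p 0 0 0 q 0 0 0 r), (mx33 (qinv p) 0 0 0 (qinv q) 0 0 0 (qinv r)).
by rewrite !mx33M !simp33 -!mulrA !qmulVl // !qmulV // !mulr1 mx33_1.
Qed.

Lemma up_swap23 x1 x2 x3 a b :
  qsimilar (upmx x1 x2 x3 a b 0) (upmx x1 x3 x2 b a 0).
Proof.
exists (mx33 1 0 0 0 0 1 0 1 0), (mx33 1 0 0 0 0 1 0 1 0).
by rewrite !mx33M !simp33 mx33_1.
Qed.

Lemma up_swap12 x1 x2 x3 b c :
  qsimilar (upmx x1 x2 x3 0 b c) (upmx x2 x1 x3 0 c b).
Proof.
exists (mx33 0 1 0 1 0 0 0 0 1), (mx33 0 1 0 1 0 0 0 0 1).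
by rewrite !mx33M !simp33 mx33_1.
Qed.

(* In C-coordinates a = a1 + a2 j the operator x |-> l x - x m is
   multiplication by l - m on x1 and by l - conj m on x2. *)
Lemma sylvester l m a : 0 <= complex.Im l -> 0 <= complex.Im m -> l != m ->
  exists x, a + x * cq m - cq l * x = 0.
Proof.
move=> l0 m0 lm.
(* If [l] were [conjc m], both imaginary parts would vanish and [l] would equal [m]. *)
have lm' : l != conjc m.
  apply: contra_neq lm; case: l l0 => r s /= s0; case: m m0 => r' s' /= s'0.
  case=> -> ss; suff : s' = 0 by move=> s'E; rewrite ss s'E oppr0.
  by apply/eqP; rewrite eq_le s'0 -oppr_ge0 -ss s0.
exists (cq (cpart1 a / (l - m)) + jq (cpart2 a / (l - conjc m))).
apply/eqP; rewrite subr_eq0; apply/eqP.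
rewrite -subr_eq0 in lm; rewrite -subr_eq0 in lm'.
by apply: cpart_inj; rewrite !cpartE; field.
Qed.

(* For l outside R the j-component of a can be removed; for l in R take x = 0. *)
Lemma sylvester_comm l a : exists x, let a' := a + x * cq l - cq l * x in
  a' * cq l = cq l * a'.
Proof.
have [lr|lr] := eqVneq l (conjc l).
  exists 0; rewrite mul0r mulr0 addr0 subr0.
  by apply: cpart_inj; rewrite !cpartE -?lr mulrC.
exists (jq (cpart2 a / (l - conjc l))) => a'; rewrite -subr_eq0 in lr.
suff -> : a' = cq (cpart1 a) by rewrite !cqM mulrC.
apply/eqP; rewrite subr_eq; apply/eqP.
by apply: cpart_inj; rewrite !cpartE //; field.
Qed.

(** * Jordan form *)

Lemma comm_qinv q x : q != 0 -> q * x = x * q -> qinv q * x = x * qinv q.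
Proof.
move=> q0 qx; rewrite -[LHS]mulr1 -(qmulV q0) mulrA -(mulrA _ x) -qx.
by rewrite (mulrA _ q) qmulVl // mul1r.
Qed.

Lemma conj_comm q x : q != 0 -> q * x = x * q -> q * x * qinv q = x.
Proof. by move=> q0 ->; rewrite -mulrA qmulV // mulr1. Qed.

Lemma qinv_neq0 q : q != 0 -> qinv q != 0.
Proof.
move=> q0; apply/eqP => qi0; move/eqP: (qmulV q0).
by rewrite qi0 mulr0 eq_sym oner_eq0.
Qed.

Lemma qmulf_neq0 q q' : q != 0 -> q' != 0 -> q * q' != 0.
Proof.
move=> q0; apply: contra_neq => /(congr1 (fun x => qinv q * x)).
by rewrite mulrA qmulVl // mul1r mulr0.
Qed.

Lemma qinv1 : qinv 1 = 1 :> H.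
Proof. by rewrite -[LHS]mul1r qmulV ?oner_eq0. Qed.

(** Complex numbers are similar in H exactly when equal or conjugate, so in the closed upper
    half-plane similarity of eigenvalues is equality. *)
Definition jordan_form (A : 'M[H]_3) := exists l1 l2 l3 : C,
  [/\ 0 <= complex.Im l1, 0 <= complex.Im l2, 0 <= complex.Im l3 &
    [\/ A = upmx (cq l1) (cq l2) (cq l3) 0 0 0,
        l1 = l2 /\ A = upmx (cq l1) (cq l2) (cq l3) 1 0 0 |
        [/\ l1 = l2, l2 = l3 & A = upmx (cq l1) (cq l2) (cq l3) 1 0 1]]].

Definition jordanizable A := exists2 J, qsimilar A J & jordan_form J.

Lemma jordanizable_similar A B :
  qsimilar A B -> jordanizable B -> jordanizable A.
Proof. by move=> AB [J BJ jJ]; exists J => //; apply: qsimilar_trans AB BJ. Qed.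

(** Once the superdiagonal entry commutes with [l], it is zero or can be scaled to 1 by its inverse,
    which also commutes with [l]. *)
Lemma jordanizable_pair l m a : 0 <= complex.Im l -> 0 <= complex.Im m ->
  jordanizable (upmx (cq l) (cq l) (cq m) a 0 0).
Proof.
move=> l0 m0; have [x] := sylvester_comm l a.
set a' := _ - _ => /= la'.
apply: jordanizable_similar (up_transvect12 x _ _ _ _ _ _) _.
rewrite -/a' mulr0 addr0.
have [->|a0] := eqVneq a' 0.
  by eexists; [exact: qsimilar_refl|exists l, l, m; split=> //; constructor 1].
eexists (upmx (cq l) (cq l) (cq m) 1 0 0); last first.
  by exists l, l, m; split=> //; constructor 2.
have n1 : (1 : H) != 0 by rewrite oner_eq0.
have := up_scale (cq l) (cq l) (cq m) a' 0 0 (qinv_neq0 a0) n1 n1.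
rewrite qinv1 !simp33 qmulVl // conj_comm ?qinv_neq0 //.
exact: comm_qinv.
Qed.

(** All three entries above the diagonal are first moved into the centralizer of [l], a division
    ring. There the nilpotent part is reduced by ordinary elimination, which leaves the diagonal
    untouched. *)
Lemma jordanizable_single l a b c : 0 <= complex.Im l ->
  jordanizable (upmx (cq l) (cq l) (cq l) a b c).
Proof.
move=> l0; have [x] := sylvester_comm l a; set a' := _ - _ => /= la.
apply: jordanizable_similar (up_transvect12 x _ _ _ _ _ _) _; rewrite -/a'.
have [y] := sylvester_comm l c; set c' := _ - _ => /= lc.
apply: jordanizable_similar (up_transvect23 y _ _ _ _ _ _) _; rewrite -/c'.
set b1 := _ - _; have [z] := sylvester_comm l b1; set b' := _ - _ => /= lb.
apply: jordanizable_similar (up_transvect13 z _ _ _ _ _ _) _; rewrite -/b'.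
have [a0|a0] := eqVneq a' 0; last have [c0|c0] := eqVneq c' 0.
- rewrite a0; have [c0|c0] := eqVneq c' 0.
    rewrite c0; apply: jordanizable_similar (up_swap23 _ _ _ _ _) _.
    exact: jordanizable_pair.
  (* As [t] commutes with [cq l], the transvection changes only the corner, to b' + t c' = 0. *)
  pose t := - (b' * qinv c').
  have lt : t * cq l = cq l * t.
    by rewrite mulNr mulrN -mulrA comm_qinv // !mulrA lb.
  apply: jordanizable_similar (up_transvect12 t _ _ _ _ _ _) _.
  rewrite lt addrK mulNr -mulrA qmulVl // mulr1 subrr.
  apply: jordanizable_similar (up_swap12 _ _ _ _ _) _.
  apply: jordanizable_similar (up_swap23 _ _ _ _ _) _.
  exact: jordanizable_pair.
- pose t := qinv a' * b'.
  have lt : t * cq l = cq l * t.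
    by rewrite -mulrA lb !mulrA comm_qinv.
  rewrite c0; apply: jordanizable_similar (up_transvect23 t _ _ _ _ _ _) _.
  rewrite lt addrK mulrA qmulV // mul1r subrr.
  exact: jordanizable_pair.
- have n1 : (1 : H) != 0 by rewrite oner_eq0.
  have lq := comm_qinv c0 lc.
  have lp : qinv c' * qinv a' * cq l = cq l * (qinv c' * qinv a').
    by rewrite -mulrA (comm_qinv a0 la) !mulrA lq.
  have q0 := qinv_neq0 c0; have p0 := qmulf_neq0 q0 (qinv_neq0 a0).
  (* The diagonal factors c'^-1 a'^-1, c'^-1, 1 turn both superdiagonal entries into 1; the corner
     is then cleared with the 1 to its left. *)
  apply: jordanizable_similar (up_scale _ _ _ _ _ _ p0 q0 n1) _.
  rewrite !conj_comm //; last by rewrite mul1r mulr1.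
  rewrite -(mulrA _ (qinv a') a') qmulVl // mulr1 qmulV // qinv1 !mulr1.
  rewrite qmulVl //; set t := _ * b'.
  have lt : t * cq l = cq l * t by rewrite -mulrA lb mulrA lp !mulrA.
  apply: jordanizable_similar (up_transvect23 t _ _ _ _ _ _) _.
  rewrite mul1r subrr lt addrK.
  eexists; first exact: qsimilar_refl.
  by exists l, l, l; split=> //; constructor 3.
Qed.

(** Entries linking distinct eigenvalues are removed by [sylvester]; permutations bring equal
    eigenvalues to the first two places. *)
Lemma jordan A : jordanizable A.
Proof.
have [l1 [l2 [l3 [a [b [c [h1 h2 h3 sA]]]]]]] := qsimilar_upmx A.
apply: jordanizable_similar sA _.
have [l12|l12] := eqVneq l1 l2.
  have [l23|l23] := eqVneq l2 l3.
    by rewrite l12 l23; apply: jordanizable_single.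
  have [x e] := sylvester c h2 h3 l23.
  apply: jordanizable_similar (up_transvect23 x _ _ _ _ _ _) _; rewrite e.
  set b' := _ - _; rewrite -l12 in l23; have [y e'] := sylvester b' h1 h3 l23.
  apply: jordanizable_similar (up_transvect13 y _ _ _ _ _ _) _; rewrite e' -l12.
  exact: jordanizable_pair.
have [x e] := sylvester a h1 h2 l12.
apply: jordanizable_similar (up_transvect12 x _ _ _ _ _ _) _; rewrite e.
move: (_ + _) => b'; have [l13|l13] := eqVneq l1 l3.
  have l23 : l2 != l3 by rewrite -l13 eq_sym.
  have [y e'] := sylvester c h2 h3 l23.
  apply: jordanizable_similar (up_transvect23 y _ _ _ _ _ _) _.
  rewrite e' mul0r subr0.
  apply: jordanizable_similar (up_swap23 _ _ _ _ _) _; rewrite -l13.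
  exact: jordanizable_pair.
have [y e'] := sylvester b' h1 h3 l13.
apply: jordanizable_similar (up_transvect13 y _ _ _ _ _ _) _; rewrite e'.
have [l23|l23] := eqVneq l2 l3.
  apply: jordanizable_similar (up_swap12 _ _ _ _ _) _.
  apply: jordanizable_similar (up_swap23 _ _ _ _ _) _; rewrite -l23.
  exact: jordanizable_pair.
have [t e''] := sylvester c h2 h3 l23.
apply: jordanizable_similar (up_transvect23 t _ _ _ _ _ _) _.
rewrite e'' mul0r subr0; eexists; first exact: qsimilar_refl.
by exists l1, l2, l3; split=> //; constructor 1.
Qed.

(** * The determinant *)

Lemma detHM n (A B : 'M[H]_n) : detH (A *m B) = detH A * detH B.
Proof. by rewrite /detH complex_repM det_mulmx. Qed.

Lemma detH1 n : detH (1%:M : 'M[H]_n) = 1.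
Proof. by rewrite /detH complex_rep1 det1. Qed.

Lemma detH_unit n (P Q : 'M[H]_n) : P *m Q = 1%:M -> detH P != 0.
Proof.
move/(congr1 (@detH R n)); rewrite detHM detH1 => PQ.
by apply/eqP => P0; move/eqP: PQ; rewrite P0 mul0r eq_sym oner_eq0.
Qed.

Lemma detH_similar n (A B : 'M[H]_n) : qsimilar A B -> detH A = detH B.
Proof.
move=> [P [Q [PQ QP /(congr1 (@detH R n))]]]; rewrite !detHM [RHS]mulrC.
by move/(mulfI (detH_unit PQ)).
Qed.

Lemma detH_diag l1 l2 l3 :
  detH (upmx (cq l1) (cq l2) (cq l3) 0 0 0) =
  l1 * l2 * l3 * conjc (l1 * l2 * l3).
Proof.
rewrite /detH /complex_rep; set D := upmx _ _ _ _ _ _.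
have -> : map_mx (@cpart2 R) D = 0.
  apply/matrixP => i j; rewrite !mxE.
  by case: i => [[|[|[|?]]] ?] //=; case: j => [[|[|[|?]]] ?].
have DE : \det (map_mx (@cpart1 R) D) = l1 * l2 * l3.
  rewrite det_trig; last first.
    apply/is_trig_mxP => i j; rewrite !mxE.
    by case: i => [[|[|[|?]]] ?] //=; case: j => [[|[|[|?]]] ?].
  rewrite !big_ord_recl big_ord0 mulr1 !mxE /= mulrA.
  by case: (l1) (l2) (l3) => [??] [??] [??].
by rewrite map_mx0 oppr0 det_ublock det_map_mx DE.
Qed.

(** Shows that a transvection has determinant 1: an invertible matrix conjugate to its own square
    has d = d^2 with d nonzero. *)
Lemma detH_double n (U V D : 'M[H]_n) : U *m V = 1%:M -> detH D != 0 ->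
  D *m U = U *m U *m D -> detH U = 1.
Proof.
move=> UV D0 /(congr1 (@detH R n)); rewrite !detHM [LHS]mulrC.
by move=> /(mulIf D0) /esym /eqP; rewrite -subr_eq0 -{3}[detH U]mulr1 -mulrBr
  mulf_eq0 (negPf (detH_unit UV)) subr_eq0 => /eqP.
Qed.

Lemma detH_upmx l1 l2 l3 a b c :
  detH (upmx (cq l1) (cq l2) (cq l3) a b c) =
  l1 * l2 * l3 * conjc (l1 * l2 * l3).
Proof.
have n2 : (2%:R : C) != 0 by rewrite pnatr_eq0.
have d2 p : cq 2%:R * p = p + p by rewrite -[2%:R]/(1 + 1) cqD mulrDl mul1r.
have d2' p : p * cq 2%:R = p + p by rewrite -[2%:R]/(1 + 1) cqD mulrDr mulr1.
have c1 : 1 = cq 1 :> H by [].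
(* Conjugation by diag(2, 2, 1) doubles the last column above the diagonal, as squaring does. *)
have U1 : detH (upmx 1 1 1 0 b c) = 1.
  apply: (@detH_double _ _ (upmx 1 1 1 0 (- b) (- c))
           (upmx (cq 2%:R) (cq 2%:R) (cq 1) 0 0 0)).
  - by rewrite mx33M !simp33 !addNr mx33_1.
  - by rewrite detH_diag !(mulf_neq0, conjc_eq0, oner_eq0).
  - by rewrite !mx33M !simp33 !d2.
have U2 : detH (upmx 1 1 1 a 0 0) = 1.
  apply: (@detH_double _ _ (upmx 1 1 1 (- a) 0 0)
           (upmx (cq 2%:R) (cq 1) (cq 1) 0 0 0)).
  - by rewrite mx33M !simp33 !addNr mx33_1.
  - by rewrite detH_diag !(mulf_neq0, conjc_eq0, oner_eq0).
  - by rewrite !mx33M !simp33 !d2.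
(* Interleaving the diagonal factors with the unipotent ones avoids dividing by an eigenvalue, so
   zero eigenvalues are covered. *)
have -> : upmx (cq l1) (cq l2) (cq l3) a b c =
  upmx (cq 1) (cq 1) (cq l3) 0 0 0 *m upmx 1 1 1 0 b c *m
  upmx (cq 1) (cq l2) (cq 1) 0 0 0 *m upmx 1 1 1 a 0 0 *m
  upmx (cq l1) (cq 1) (cq 1) 0 0 0.
  by rewrite !mx33M !simp33.
rewrite !detHM U1 U2 !detH_diag !mulr1 !mul1r !rmorphM /=.
by ring.
Qed.

Lemma detH_scale n (t : R) (A : 'M[H]_n) :
  detH ((realq t)%:M *m A) = (t%:C)%C ^+ (n + n) * detH A.
Proof.
rewrite detHM; congr (_ * _); rewrite /detH -det_scalar; congr (\det _).
rewrite [RHS](@scalar_mx_block _ n n) /complex_rep.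
have e1 : map_mx (@cpart1 R) (realq t)%:M = (t%:C%C)%:M :> 'M_n.
  by apply/matrixP => i j; rewrite !mxE; case: (i == j).
have e2 : map_mx (@cpart2 R) (realq t)%:M = 0 :> 'M_n.
  by apply/matrixP => i j; rewrite !mxE; case: (i == j).
rewrite e1 e2 map_mx0 oppr0; congr block_mx.
by apply/matrixP => i j; rewrite !mxE; case: (i == j);
  rewrite ?mulr1n ?mulr0n ?conjc_real ?conjc0.
Qed.

(** * From GL(3, H) to SL(3, H) *)

Lemma qsimilar_sym n (A B : 'M[H]_n) : qsimilar A B -> qsimilar B A.
Proof.
move=> [P [Q [PQ QP eP]]]; exists Q, P; split=> //.
by rewrite -[LHS]mulmx1 -PQ mulmxA -(mulmxA Q) -eP !mulmxA QP mul1mx.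
Qed.

(** After triangularization the determinant is |l1 l2 l3|^2, and it is nonzero. *)
Lemma detH_gt0 (P Q : 'M[H]_3) : P *m Q = 1%:M ->
  exists2 r : R, 0 < r & detH P = (r%:C)%C.
Proof.
move=> PQ; have P0 := detH_unit PQ.
have [l1 [l2 [l3 [a [b [c [_ _ _ sP]]]]]]] := qsimilar_upmx P.
move: P0; rewrite (detH_similar sP) detH_upmx; move: (_ * _ * l3) => z z0.
have : 0 < z * conjc z by rewrite lt_neqAle mulcJ_ge0 eq_sym z0.
by case: (z * _) => r s; rewrite ltcE /= => /andP[/eqP-> r0]; exists r.
Qed.

(** A real scalar t multiplies [detH] by t^6 in size 3, so this is the factor that normalizes it to
    1. *)
Lemma root6 (r : R) : 0 < r -> exists2 t : R, 0 < t & t ^+ 6 * r = 1.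
Proof.
move=> r0; exists (expR (- ln r / 6%:R)); first exact: expR_gt0.
rewrite -expRM_natl mulrCA divff ?pnatr_eq0 // mulr1 expRN lnK //.
by rewrite mulVf // gt_eqF.
Qed.

Lemma scalar_realq_comm n (t : R) (A : 'M[H]_n) :
  (realq t)%:M *m A = A *m (realq t)%:M.
Proof.
rewrite mul_scalar_mx; apply/matrixP => i j.
rewrite !mxE (bigD1 j) //= big1 ?addr0 => [|k kj].
  rewrite mxE eqxx mulr1n; case: (A i j) => a b c d.
  by congr Quaternion; ring.
by rewrite mxE (negPf kj) mulr0n mulr0.
Qed.

Lemma SL3_scale (P Q : 'M[H]_3) : P *m Q = 1%:M ->
  exists g : SL3, exists t : R, val g = (realq t)%:M *m P.
Proof.
move=> PQ; have [r r0 rP] := detH_gt0 PQ; have [t t0 tr] := root6 r0.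
have dt : SLH_pred ((realq t)%:M *m P).
  by rewrite /SLH_pred detH_scale rP -rmorphXn -rmorphM /= tr.
by exists (MkSLH dt), t.
Qed.

Lemma conjugateP (A B : SL3) :
  conjugate A B <-> qsimilar (val A) (val B).
Proof.
split=> [[g <-]|].
  exists (val g^-1%g), (val g); split.
  - by have /(congr1 val) := mulVg g.
  - by have /(congr1 val) := mulgV g.
  - have /(congr1 val) : (g^-1 * A = A ^ g * g^-1)%g; last by [].
    by rewrite conjgE mulgA mulgK.
(* As [A ^ g] is g^-1 A g, the conjugator must satisfy A g = g B, hence the reversed similarity. A
   real multiple of [P] lies in SL(3, H) and, real scalars being central, satisfies the same
   equation. *)
move=> /qsimilar_sym[P [Q [PQ _ eP]]]; have [g [t gE]] := SL3_scale PQ.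
exists g; rewrite conjgE; apply: (mulgI g); rewrite mulVKg.
apply: val_inj; rewrite /= gE.
by rewrite mulmxA -scalar_realq_comm -!mulmxA eP.
Qed.

Lemma SL3_similar (A : SL3) M : qsimilar (val A) M ->
  exists2 B : SL3, val B = M & conjugate A B.
Proof.
move=> AM; have dM : SLH_pred M.
  by rewrite /SLH_pred -(detH_similar AM) SLH_detE.
by exists (MkSLH dM) => //; apply/conjugateP.
Qed.

Lemma reversible_conj (G : groupType) (x y : G) :
  conjugate x y -> reversible x -> reversible y.
Proof.
move=> [g <-] [h xh]; exists (h ^ g)%g.
by rewrite -conjJg xh conjVg.
Qed.

Lemma conjugate_sym (G : groupType) (x y : G) : conjugate x y -> conjugate y x.
Proof. by move=> [g <-]; exists (g^-1)%g; rewrite conjgK. Qed.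

(** The equation A g A = g contains no inverse of A, so it can be read row by row. *)
Lemma reversibleP (A : SL3) : reversible A <->
  exists g g' : 'M[H]_3,
    [/\ g *m g' = 1%:M, g' *m g = 1%:M & val A *m g *m val A = g].
Proof.
have VA : val A^-1%g *m val A = 1%:M by have /(congr1 val) := mulVg A.
have AV : val A *m val A^-1%g = 1%:M by have /(congr1 val) := mulgV A.
rewrite /reversible conjugateP; split=> [/qsimilar_sym|].
  move=> [P [Q [PQ QP eP]]]; exists P, Q; split=> //.
  by rewrite -eP -mulmxA VA mulmx1.
move=> [g [g' [gg' g'g eg]]]; exists g, g'; split=> //.
by rewrite -{2}eg !mulmxA VA mul1mx.
Qed.

(** * Eigenvalues of reversible elements *)

Definition unitc (t : R) : C := Complex (cos t) (sin t).

Lemma unitcJ t : unitc t * conjc (unitc t) = 1.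
Proof.
apply/eqP; rewrite eq_complex /= mulrN opprK -!expr2 cos2Dsin2 eqxx /=.
by rewrite mulrN mulrC addNr.
Qed.

Lemma unitc_halfplane l : 0 <= complex.Im l -> l * conjc l = 1 ->
  exists2 t, 0 <= t <= pi & l = unitc t.
Proof.
case: l => r s /= s0 /eqP; rewrite eq_complex /= => /andP[/eqP e _].
have {}e : r ^+ 2 + s ^+ 2 = 1 by rewrite -e; ring.
have r1 : -1 <= r <= 1.
  rewrite -ler_norml -(@expr_le1 _ 2) // real_normK ?num_real //.
  by rewrite -e lerDl sqr_ge0.
(* On [0, pi] the sine is nonnegative, hence equal to [s], the nonnegative root of 1 - r^2. *)
exists (acos r); first by rewrite acos_ge0 // acos_lepi.
rewrite /unitc acosK ?in_itv // sin_acos //.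
by rewrite -e addrAC subrr add0r sqrtr_sqr ger0_norm.
Qed.

(** For q = q1 + q2 j the hypothesis splits into l q1 m = q1 and l q2 conj(m) = q2. If q2 is nonzero
    this is the claim; otherwise l m = 1, which forces both numbers of the half-plane to be real. *)
Lemma conj_inv_of_comm l m q : 0 <= complex.Im l -> 0 <= complex.Im m ->
  q != 0 -> cq l * (q * cq m) = q -> l * conjc m = 1.
Proof.
move=> l0 m0 q0 e.
have e1 : l * (cpart1 q * m) = cpart1 q by rewrite -[in RHS]e !cpartE.
have e2 : l * (cpart2 q * conjc m) = cpart2 q by rewrite -[in RHS]e !cpartE.
have [q2|q2] := eqVneq (cpart2 q) 0; last first.
  by apply: (mulIf q2); rewrite mul1r -[RHS]e2; ring.
have q1 : cpart1 q != 0.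
  by apply: contra_neq q0 => q1; apply: cpart_inj; rewrite ?q1 ?q2.
have {e1} : l * m = 1 by apply: (mulIf q1); rewrite mul1r -[RHS]e1; ring.
case: l m l0 m0 {e e2} => a b [c d] /= b0 d0 /eqP.
rewrite eq_complex /= => /andP[/eqP e1 /eqP e2].
have d0' : d = 0.
  apply/eqP; rewrite eq_le d0 andbT -oppr_ge0.
  suff -> : - d = b * (c ^+ 2 + d ^+ 2) by rewrite mulr_ge0 ?addr_ge0 ?sqr_ge0.
  have ad : a * d = - (b * c) by apply/eqP; rewrite -addr_eq0 e2.
  by rewrite -[d in LHS]mulr1 -e1 mulrBr; ring: ad.
move: e1 e2; rewrite d0' !mulr0 subr0 add0r => e1 e2.
by apply/eqP; rewrite eq_complex /= oppr0 !mulr0 subr0 add0r e1 e2 !eqxx.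
Qed.

Lemma sum_ord3 (V : nmodType) (F : 'I_3 -> V) :
  \sum_k F k = F 0 + F 1 + F 2%:R.
Proof.
rewrite !big_ord_recl big_ord0 addr0 addrA.
by congr (F _ + F _ + F _); apply: val_inj.
Qed.

(** The last hypothesis says that row [i] of [T] is [l] times a standard basis row. Row [i] of
    [T *m g *m T = g] then involves only row [i] of [g], which is nonzero by invertibility. *)
Lemma reversible_eigenvalue (g g' : 'M[H]_3) i l l1 l2 l3 a b c :
    0 <= complex.Im l -> 0 <= complex.Im l1 -> 0 <= complex.Im l2 ->
    0 <= complex.Im l3 ->
  let T := upmx (cq l1) (cq l2) (cq l3) a b c in
  g *m g' = 1%:M -> T *m g *m T = g ->
  (forall (X : 'M[H]_3) j, (T *m X) i j = cq l * X i j) ->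
  [\/ l * conjc l1 = 1, l * conjc l2 = 1 | l * conjc l3 = 1].
Proof.
move=> h h1 h2 h3 T gg' eg eT.
have e j : cq l * (g *m T) i j = g i j by rewrite -eT mulmxA eg.
have {e} : [/\ cq l * (g i 0 * cq l1) = g i 0,
    cq l * (g i 0 * a + g i 1 * cq l2) = g i 1 &
    cq l * (g i 0 * b + g i 1 * c + g i 2%:R * cq l3) = g i 2%:R].
  by move: (e 0) (e 1) (e 2%:R); rewrite !mxE !sum_ord3 !mxE /= !simp33.
case=> e0 e1 e2.
have [g0|g0] := eqVneq (g i 0) 0; last first.
  by constructor 1; apply: conj_inv_of_comm e0.
move: e1 e2; rewrite g0 !mul0r !add0r => e1 e2.
have [g1|g1] := eqVneq (g i 1) 0; last first.
  by constructor 2; apply: conj_inv_of_comm e1.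
move: e2; rewrite g1 !mul0r !add0r => e2.
have [g2|g2] := eqVneq (g i 2%:R) 0; last first.
  by constructor 3; apply: conj_inv_of_comm e2.
have : (g *m g') i i = 1 by rewrite gg' mxE eqxx.
rewrite mxE sum_ord3 g0 g1 g2 !mul0r !addr0 => /eqP.
by rewrite eq_sym oner_eq0.
Qed.

Lemma reversible_of_sqrN1 (B : SL3) (g : 'M[H]_3) :
  g *m g = - 1%:M -> val B *m g *m val B = g -> reversible B.
Proof.
move=> gg eg; apply/reversibleP; exists g, (- g).
by rewrite mulmxN mulNmx gg opprK.
Qed.

(** * Normal forms *)

Definition reversible_normal_form (M : 'M[H]_3) :=
    [\/ exists theta phi psi : R,
          [/\ 0 <= theta <= pi, 0 <= phi <= pi, 0 <= psi <= pi &
           M = mx33 (expiq theta) 0 0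
                    0 (expiq phi) 0
                    0 0 (expiq psi)],
        exists r theta psi : R,
          [/\ 0 < r /\ r != 1, 0 <= theta <= pi, 0 <= psi <= pi &
           M = mx33 (realq r * expiq theta) 0 0
                    0 (realq r^-1 * expiq theta) 0
                    0 0 (expiq psi)],
        exists theta psi : R,
          [/\ 0 <= theta <= pi, 0 <= psi <= pi &
           M = mx33 (expiq theta) 1 0
                    0 (expiq theta) 0
                    0 0 (expiq psi)]
      | exists theta : R,
          0 <= theta <= pi /\
           M = mx33 (expiq theta) 1 0
                    0 (expiq theta) 1
                    0 0 (expiq theta)].

Lemma expiqE t : expiq t = cq (unitc t) :> H. Proof. by []. Qed.
Lemma realq_expiqE r t : realq r * expiq t = cq ((r%:C)%C * unitc t) :> H.
Proof. by rewrite -cqM. Qed.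

Lemma mx33_opp1 : mx33 (-1) 0 0 0 (-1) 0 0 0 (-1) = - 1%:M :> 'M[H]_3.
Proof.
rewrite -mx33_1; apply/matrixP => i j; rewrite !mxE.
by case: i => [[|[|[|?]]] ?] //=; case: j => [[|[|[|?]]] ?] //=; rewrite oppr0.
Qed.

Lemma conjcM z w : conjc (z * w) = conjc z * conjc w.
Proof. exact: rmorphM. Qed.

Lemma unitc_conj (t : R) : exists2 m : C, unitc t * m = 1 &
  conjc (unitc t) = m /\ conjc m = unitc t.
Proof. by exists (conjc (unitc t)); rewrite ?unitcJ ?conjcK. Qed.

Lemma conjcX n m l : conjc m = l -> conjc (m ^+ n) = l ^+ n.
Proof. by move=> <-; rewrite rmorphXn. Qed.

Lemma conjcN2 m l : conjc m = l -> conjc (- m ^+ 2) = - l ^+ 2.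
Proof. by move=> <-; rewrite rmorphN rmorphXn. Qed.

(* If a complex P satisfies T P conj(T) = P and P conj(P) = 1, then g = P j
   satisfies T g T = g and g^2 = -1. *)
Lemma normal_form_reversible (B : SL3) :
  reversible_normal_form (val B) -> reversible B.
Proof.
have cqN1 : cq (-1) = -1 :> H by apply: (addIr (cq 1)); rewrite -cqD !addNr.
case=> [[t1 [t2 [t3 [_ _ _ BE]]]]|[r [t [s [[r0 r1] _ _ BE]]]]
       |[t [s [_ _ BE]]]|[t [_ BE]]].
- apply: (@reversible_of_sqrN1 _ (mx33 (jq 1) 0 0 0 (jq 1) 0 0 0 (jq 1))).
    by rewrite mx33M !simp33 !jqM conjc1 mulr1 cqN1 mx33_opp1.
  rewrite BE !mx33M !simp33 !expiqE !cqjM !jcqM.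
  by rewrite !mulr1 !unitcJ.
(* P exchanges the first two coordinates, so that r meets r^-1. *)
- apply: (@reversible_of_sqrN1 _ (mx33 0 (jq 1) 0 (jq 1) 0 0 0 0 (jq 1))).
    by rewrite mx33M !simp33 !jqM conjc1 mulr1 cqN1 mx33_opp1.
  rewrite BE !mx33M !simp33 !realq_expiqE !expiqE !cqjM !jcqM.
  rewrite !mulr1 !conjcM !conjc_real !unitcJ mulrACA unitcJ mulr1.
  rewrite (mulrACA (r^-1)%:C%C) unitcJ mulr1 -!rmorphM /=.
  by rewrite mulfV ?mulVf ?gt_eqF.
- have [m lm [cl cm]] := unitc_conj t; set l := unitc t in lm cl cm BE *.
  (* Here [m] is the inverse of [l]; with [- m ^+ 2] the off-diagonal contributions -m and m to T P
     conj(T) cancel. *)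
  pose g : 'M[H]_3 := mx33 (jq (- m ^+ 2)) 0 0 0 (jq 1) 0 0 0 (jq 1).
  apply: (@reversible_of_sqrN1 _ g); rewrite /g.
    rewrite mx33M !simp33 !jqM conjc1 mulr1 -mx33_opp1 -cqN1.
    rewrite (conjcN2 cm).
    by congr mx33; congr cq; ring: lm.
  rewrite BE !mx33M !simp33 !expiqE -/l !cqjM -?jqD !jcqM -?jqD cl.
  rewrite (mulr1 (unitc s)) unitcJ.
  by congr mx33; rewrite -?jq0; congr jq; ring: lm.
- have [m lm [cl cm]] := unitc_conj t; set l := unitc t in lm cl cm BE *.
  (* Solving T P conj(T) = P upwards from the last row (0, 0, 1) forces the diagonal m^4, -m^2, 1;
     taking 0 as last entry of the second row then forces m^3. *)
  pose g : 'M[H]_3 := mx33 (jq (m ^+ 4)) (jq (m ^+ 3)) 0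
                           0 (jq (- m ^+ 2)) 0 0 0 (jq 1).
  apply: (@reversible_of_sqrN1 _ g); rewrite /g.
    rewrite mx33M !simp33 !jqM conjc1 mulr1 -mx33_opp1 -cqN1 -cqD.
    rewrite (conjcN2 cm) (conjcX 3 cm) (conjcX 4 cm) -cq0.
    by congr mx33; congr cq; ring: lm.
  rewrite BE !mx33M !simp33 !expiqE -/l !cqjM -?jqD !jcqM -?jqD cl.
  by congr mx33; rewrite -?jq0; congr jq; ring: lm.
Qed.

(** * From reversibility to a normal form *)

Lemma polar l : 0 <= complex.Im l -> l != 0 -> exists r t : R,
  [/\ 0 < r, 0 <= t <= pi & l = (r%:C)%C * unitc t].
Proof.
case: l => a b /= b0 l0; pose r := Num.sqrt (a ^+ 2 + b ^+ 2).
have n0 : 0 <= a ^+ 2 + b ^+ 2 by rewrite addr_ge0 ?sqr_ge0.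
have r0 : 0 < r.
  rewrite sqrtr_gt0 lt_neqAle n0 andbT eq_sym paddr_eq0 ?sqr_ge0 //.
  rewrite !expf_eq0 /=; apply: contra l0 => /andP[/eqP-> /eqP->].
  by [].
have rE : r ^+ 2 = a ^+ 2 + b ^+ 2 by rewrite sqr_sqrtr.
have rn : r != 0 by rewrite gt_eqF.
have [||t ht e] := @unitc_halfplane (Complex (a / r) (b / r)).
- by rewrite /= divr_ge0 // ltW.
- apply/eqP; rewrite eq_complex /=; apply/andP; split; apply/eqP; last by ring.
  have -> : a / r * (a / r) - b / r * - (b / r) = (a ^+ 2 + b ^+ 2) / r ^+ 2.
    by field.
  by rewrite -rE divff // expf_neq0.
exists r, t; split=> //; rewrite -e; apply/eqP; rewrite eq_complex /=.
by rewrite !mul0r subr0 addr0 ![r * _]mulrC !divfK // !eqxx.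
Qed.

Definition has_normal_form M :=
  exists2 N, qsimilar M N & reversible_normal_form N.

Lemma has_normal_form_similar A B :
  qsimilar A B -> has_normal_form B -> has_normal_form A.
Proof. by move=> AB [J BJ jJ]; exists J => //; apply: qsimilar_trans AB BJ. Qed.

(** The number 1 / conj(l1) has the argument of l1 and the inverse modulus, so |l1 l2| = 1 and the
    determinant makes l3 unimodular. *)
Lemma has_normal_form_pair l1 l2 l3 : 0 <= complex.Im l1 ->
    0 <= complex.Im l3 ->
    l1 * l2 * l3 * conjc (l1 * l2 * l3) = 1 ->
    l1 * conjc l2 = 1 -> l1 * conjc l1 != 1 ->
  has_normal_form (upmx (cq l1) (cq l2) (cq l3) 0 0 0).
Proof.
move=> h1 h3 dt e12 n1.
have e21 : conjc l1 * l2 = 1 by rewrite -[l2]conjcK -rmorphM e12 rmorph1.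
have n3 : l3 * conjc l3 = 1 by rewrite -dt !conjcM; ring: e12 e21.
have l10 : l1 != 0.
  by apply: contra_eq_neq e12 => ->; rewrite mul0r eq_sym oner_eq0.
have [r [t [r0 ht e1]]] := polar h1 l10.
have [s hs e3] := unitc_halfplane h3 n3.
have e2 : l2 = (r^-1%:C)%C * unitc t.
  have c0 : conjc l1 != 0 by rewrite conjc_eq0.
  apply: (mulfI c0); rewrite e21 e1 conjcM conjc_real mulrACA -rmorphM /=.
  by rewrite mulfV ?gt_eqF // mul1r mulrC unitcJ.
eexists; first exact: qsimilar_refl.
constructor 2; exists r, t, s; split=> //; last first.
  by rewrite !realq_expiqE expiqE -e1 -e2 -e3.
by split=> //; apply: contra_neq n1 => r1; rewrite e1 r1 mul1r unitcJ.
Qed.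

Lemma has_normal_form_reversible (A : SL3) :
  reversible A -> has_normal_form (val A).
Proof.
move=> rA; have [J AJ jJ] := jordan (val A).
have [B BJ AB] := SL3_similar AJ.
have /reversibleP[g [g' [gg' _]]] := reversible_conj AB rA; rewrite BJ => eg.
apply: has_normal_form_similar AJ _.
have dB : detH J = 1 by rewrite -BJ SLH_detE.
case: jJ => l1 [l2 [l3 [h1 h2 h3 cases]]].
case: cases => [JE|[e12 JE]|[e12 e23 JE]].
- have dt : l1 * l2 * l3 * conjc (l1 * l2 * l3) = 1 by rewrite -dB JE detH_upmx.
  rewrite JE in eg *.
  have E i l (hl : 0 <= complex.Im l) :=
    reversible_eigenvalue (i := i) hl h1 h2 h3 gg' eg.
  have E1 : [\/ l1 * conjc l1 = 1, l1 * conjc l2 = 1 | l1 * conjc l3 = 1].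
    by apply: (E 0) => // X j; rewrite !mxE sum_ord3 !mxE /= !simp33.
  have E2 : [\/ l2 * conjc l1 = 1, l2 * conjc l2 = 1 | l2 * conjc l3 = 1].
    by apply: (E 1) => // X j; rewrite !mxE sum_ord3 !mxE /= !simp33.
  (* A non-unimodular eigenvalue has its partner at another place; swaps bring the two to the
     front. *)
  have [n1|n1] := eqVneq (l1 * conjc l1) 1; last first.
    case: E1 => [e|e|e]; first by rewrite e eqxx in n1.
      exact: has_normal_form_pair.
    apply: has_normal_form_similar (up_swap23 _ _ _ _ _) _.
    by apply: has_normal_form_pair => //; rewrite -dt !conjcM; ring.
  have [n2|n2] := eqVneq (l2 * conjc l2) 1; last first.
    case: E2 => [e|e|e]; last 1 first.
    + apply: has_normal_form_similar (up_swap12 _ _ _ _ _) _.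
      apply: has_normal_form_similar (up_swap23 _ _ _ _ _) _.
      by apply: has_normal_form_pair => //; rewrite -dt !conjcM; ring.
    + apply: has_normal_form_similar (up_swap12 _ _ _ _ _) _.
      by apply: has_normal_form_pair => //; rewrite -dt !conjcM; ring.
    + by rewrite e eqxx in n2.
  have n3 : l3 * conjc l3 = 1 by rewrite -dt !conjcM; ring: n1 n2.
  have [[t1 ht1 ->] [t2 ht2 ->]] :=
    (unitc_halfplane h1 n1, unitc_halfplane h2 n2).
  have [t3 ht3 ->] := unitc_halfplane h3 n3.
  eexists; first exact: qsimilar_refl.
  by constructor 1; exists t1, t2, t3.
- subst l2.
  have dt : l1 * l1 * l3 * conjc (l1 * l1 * l3) = 1 by rewrite -dB JE detH_upmx.
  rewrite JE in eg *.
  have E : [\/ l1 * conjc l1 = 1, l1 * conjc l1 = 1 | l1 * conjc l3 = 1].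
    (* In the 2 x 2 block only the second row is a multiple of a basis row. *)
    apply: (reversible_eigenvalue (i := 1) h1 h1 h1 h3 gg' eg) => X j.
    by rewrite !mxE sum_ord3 !mxE /= !simp33.
  have n1 : l1 * conjc l1 = 1.
    (* If l1 conj(l3) = 1, the condition |l1|^4 |l3|^2 = 1 reduces to |l1|^2 = 1. *)
    case: E => // e; rewrite -dt !conjcM.
    have e' : conjc l1 * l3 = 1 by rewrite -[l3]conjcK -rmorphM e rmorph1.
    by ring: e e'.
  have n3 : l3 * conjc l3 = 1 by rewrite -dt !conjcM; ring: n1.
  have [[t1 ht1 ->] [t3 ht3 ->]] :=
    (unitc_halfplane h1 n1, unitc_halfplane h3 n3).
  eexists; first exact: qsimilar_refl.
  by constructor 3; exists t1, t3.
- subst l2 l3; rewrite JE in eg *.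
  have n1 : l1 * conjc l1 = 1.
    suff : [\/ l1 * conjc l1 = 1, l1 * conjc l1 = 1 | l1 * conjc l1 = 1].
      by case.
    (* The last row is the eigenrow of the full Jordan block, and the three alternatives
       coincide. *)
    apply: (reversible_eigenvalue (i := 2%:R) h1 h1 h1 h1 gg' eg) => X j.
    by rewrite !mxE sum_ord3 !mxE /= !simp33.
  have [t ht ->] := unitc_halfplane h1 n1.
  eexists; first exact: qsimilar_refl.
  by constructor 4; exists t.
Qed.

End ReversibleSL3H.

Theorem theorem3p3 (R : realType) (A : SLH R 3) :
  reversible A <->
  exists B : SLH R 3, conjugate A B /\
    [\/ exists theta phi psi : R,
          [/\ 0 <= theta <= pi, 0 <= phi <= pi, 0 <= psi <= pi &
           SLH_val B = mx33 (expiq theta) 0 0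
                            0 (expiq phi) 0
                            0 0 (expiq psi)],
        exists r theta psi : R,
          [/\ 0 < r /\ r != 1, 0 <= theta <= pi, 0 <= psi <= pi &
           SLH_val B = mx33 (realq r * expiq theta) 0 0
                            0 (realq r^-1 * expiq theta) 0
                            0 0 (expiq psi)],
        exists theta psi : R,
          [/\ 0 <= theta <= pi, 0 <= psi <= pi &
           SLH_val B = mx33 (expiq theta) 1 0
                            0 (expiq theta) 0
                            0 0 (expiq psi)]
      | exists theta : R,
          0 <= theta <= pi /\
           SLH_val B = mx33 (expiq theta) 1 0
                            0 (expiq theta) 1
                            0 0 (expiq theta)].
Proof.
split=> [rA|[B [AB nB]]].
  have [M AM nM] := has_normal_form_reversible rA.
  have [B BM AB] := SL3_similar AM.
  by exists B; split=> //; rewrite -BM in nM.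
exact: reversible_conj (conjugate_sym AB) (normal_form_reversible nB).
Qed.
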